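(* Let $(\Omega,S)$ be an equivalenced scheme such that condition (A) holds for all $u,v\in S^\#$ and condition (B) holds for all $u,v,w\in S^\#$. Let $\alpha_0\in\Omega$. Then the basis relation set of the $\alpha_0$-extension is $$S_{\alpha_0}=S_0(\alpha_0)\cup S_1(\alpha_0).$$ In particular, the $\alpha_0$-extension $(\Omega,S_{\alpha_0})$ is semiregular on $\Omega\setminus\{\alpha_0\}$, and its fibers are exactly the sets $\alpha_0u$, $u\in S$.
   Context: A coherent configuration is a pair $(\Omega,S)$ with $\Omega$ finite and $S$ a partition of $\Omega\times\Omega$ such that the diagonal $1_\Omega$ is a union of elements of $S$, $S$ is closed under $r\mapsto r^*=\{(\beta,\alpha):(\alpha,\beta)\in r\}$, and for $r,s,t\in S$ the number $c_{rs}^t=|\{\beta:(\alpha,\beta)\in r,(\beta,\gamma)\in s\}|$ does not depend on $(\alpha,\gamma)\in t$. A scheme is one with $1_\Omega\in S$; $S^\#=S\setminus\{1_\Omega\}$; $\alpha s=\{\beta:(\alpha,\beta)\in s\}$, $n_s=|\alpha s|$; equivalenced means all $n_s$, $s\in S^\#$, are equal. Fibers of a coherent configuration $(\Omega,T)$ are the sets $\Delta$ with $1_\Delta=\{(\delta,\delta):\delta\in\Delta\}\in T$. For $\alpha\in\Omega$, the $\alpha$-extension $(\Omega,S_\alpha)$ is the coarsest coherent configuration on $\Omega$ such that $\{(\alpha,\alpha)\}$ and every $s\in S$ are unions of its basis relations. It is semiregular on $\Omega\setminus\{\alpha\}$ if $|\{\gamma:(\beta,\gamma)\in s\}|\le1$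 for all $\beta\ne\alpha$ and all $s\in S_\alpha$ with $s\subseteq(\Omega\setminus\{\alpha\})^2$. Composition: $r\cdot s=\{(\alpha,\gamma):\exists\beta,(\alpha,\beta)\in r,(\beta,\gamma)\in s\}$, $X\cdot Y=\{x\cdot y:x\in X,y\in Y\}$; for $r,s\in S$, $rs$ is the set of elements of $S$ contained in $r\cdot s$, and $XY=\bigcup_{x\in X,y\in Y}xy$ for $X,Y\subseteq S$. Splitting set: $D(u,v)=\{w\in S^\#:((uu^* )(vv^* ))\cap ww^*=\{1_\Omega\}\}$. Condition (A) for $u,v$: for all $w,w'\in D(u,v)$, $\bigcap_{a\in\{u,v\},b\in\{w,w'\}}D(a,b)\ne\emptyset$. Condition (B) for $u,v,w$: $D(u,v)\cap D(v,w)\cap D(w,u)\neq\emptyset$. For $u,v\in S$: $S_{\alpha_0}(u,v)=\{s\cap(\alpha_0u\times\alpha_0v):s\in u^*v\}$ and $S_{\alpha_0}(u,v;w)=S_{\alpha_0}(u,w)\cdot S_{\alpha_0}(w,v)$. Define $S_0(\alpha_0)=\bigcup_{u,v\in S^\#}S_{\alpha_0}(u,v;w_{u,v})$ where $w_{u,v}$ is any element of $D(u,v)$ (under (A),(B) this set is nonempty and the result is independent of the choice), and $S_1(\alpha_0)=\{\{\alpha_0\}\times\alpha_0v:v\in S\}\cup\{\alpha_0v\times\{\alpha_0\}:v\in S\}$. *)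

(* Defs.v *)
From mathcomp Require Import all_boot.
Set Implicit Arguments.
Unset Strict Implicit.
Unset Printing Implicit Defensive.

Section CC.
Variable O : finType.

Notation rel2 := {set O * O}.
Notation rels := {set {set O * O}}.

Definition diag_on (D : {set O}) : rel2 := [set (x, x) | x in D].
Definition diagO : rel2 := diag_on setT.

Definition rtr (r : rel2) : rel2 := [set (p.2, p.1) | p in r].

Definition nbr (a : O) (r : rel2) : {set O} := [set b | (a, b) \in r].

Definition cnum (r s : rel2) (a c : O) : nat :=
  #|[set b | ((a, b) \in r) && ((b, c) \in s)]|.

Definition union_of (T : rels) (x : rel2) : Prop :=
  exists P : rels, P \subset T /\ cover P = x.

Definition is_cc (S : rels) : Prop :=
  [/\ partition S [set: O * O],
      union_of S diagO,
      (forall r, r \in S -> rtr r \in S) &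
      (forall r s t, r \in S -> s \in S -> t \in S ->
         forall p q, p \in t -> q \in t -> cnum r s p.1 p.2 = cnum r s q.1 q.2)].

Definition is_scheme (S : rels) : Prop := is_cc S /\ diagO \in S.

Definition Ssharp (S : rels) : rels := S :\ diagO.

Definition equivalenced (S : rels) : Prop :=
  forall s t, s \in Ssharp S -> t \in Ssharp S ->
    forall a b, #|nbr a s| = #|nbr b t|.

Definition rcomp (r s : rel2) : rel2 :=
  [set p | [exists b, ((p.1, b) \in r) && ((b, p.2) \in s)]].

Definition rcompS (X Y : rels) : rels := [set rcomp x y | x in X, y in Y].

Definition relprod (S : rels) (r s : rel2) : rels :=
  [set t in S | t \subset rcomp r s].

Definition relprodS (S : rels) (X Y : rels) : rels :=
  \bigcup_(x in X) \bigcup_(y in Y) relprod S x y.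

Definition Dsplit (S : rels) (u v : rel2) : rels :=
  [set w in Ssharp S |
     relprodS S (relprod S u (rtr u)) (relprod S v (rtr v))
       :&: relprod S w (rtr w) == [set diagO]].

Definition condA (S : rels) (u v : rel2) : Prop :=
  forall w w', w \in Dsplit S u v -> w' \in Dsplit S u v ->
    Dsplit S u w :&: Dsplit S u w' :&: Dsplit S v w :&: Dsplit S v w' != set0.

Definition condB (S : rels) (u v w : rel2) : Prop :=
  Dsplit S u v :&: Dsplit S v w :&: Dsplit S w u != set0.

(* the alpha-extension, characterised as the coarsest coherent configuration
   such that {(a,a)} and every s in S are unions of its basis relations *)
Definition ext_admissible (S : rels) (a : O) (T : rels) : Prop :=
  [/\ is_cc T, union_of T [set (a, a)] & forall s, s \in S -> union_of T s].

Definition is_extension (S : rels) (a : O) (T : rels) : Prop :=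
  ext_admissible S a T /\
  forall T', ext_admissible S a T' -> forall t, t \in T -> union_of T' t.

Definition semiregular_off (a : O) (T : rels) : Prop :=
  forall b, b != a -> forall s, s \in T -> s \subset setX [set~ a] [set~ a] ->
    #|nbr b s| <= 1.

Definition fibers (T : rels) : {set {set O}} := [set D | diag_on D \in T].

Definition Sa (S : rels) (a : O) (u v : rel2) : rels :=
  [set s :&: setX (nbr a u) (nbr a v) | s in relprod S (rtr u) v].

Definition Saw (S : rels) (a : O) (u v w : rel2) : rels :=
  rcompS (Sa S a u w) (Sa S a w v).

(* S_0(a0), with w_{u,v} given by a selector wsel *)
Definition S0 (S : rels) (a : O) (wsel : rel2 -> rel2 -> rel2) : rels :=
  \bigcup_(u in Ssharp S) \bigcup_(v in Ssharp S) Saw S a u v (wsel u v).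

Definition S1 (S : rels) (a : O) : rels :=
  [set setX [set a] (nbr a v) | v in S] :|: [set setX (nbr a v) [set a] | v in S].

End CC.

(* Main.v *)
(** Write [a u] for the neighbours of [a] in colour [u].  If [w] splits [(u, v)],
    then, all valencies being equal, the colours between [a u] and [a w] are
    perfect matchings, and composing such a matching with one between [a w] and
    [a v] gives a matching contained in a single colour.  Condition (A) provides
    an intermediate [q] through which both steps factor; hence two composites
    sharing an edge coincide, whatever the choice of [w].  Condition (B) lets two
    consecutive composites pass through the same [w], so their composition is
    again one of them.  The matchings thus form a groupoid, and adding the blocks
    at [a] gives a coherent configuration; it is the coarsest one because its
    relations are built from [(a, a)] and [S] by composition, transposition and
    intersection. *)

Require Import Defs.
From mathcomp Require Import all_boot.

Set Implicit Arguments.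
Unset Strict Implicit.
Unset Printing Implicit Defensive.

(** * Unions of partition classes and elementary operations on relations *)

(** Rephrasing unions of classes as saturated sets lets closure properties be checked point by
    point. *)
Lemma union_ofP (O : finType) (T : {set {set O * O}}) (X : {set O * O}) :
  partition T [set: O * O] ->
  union_of T X <->
  (forall p q, pblock T p = pblock T q -> p \in X -> q \in X).
Proof.
case/and3P=> /eqP covT tiT _; split.
  case=> P [/subsetP sPT <-] p q eq_pq /bigcupP[B PB Bp].
  apply/bigcupP; exists B => //.
  by rewrite -(def_pblock tiT (sPT _ PB) Bp) eq_pq mem_pblock covT inE.
move=> clX; exists [set t in T | t \subset X]; split.
  by apply/subsetP=> t; rewrite inE => /andP[].
apply/setP=> p; apply/bigcupP/idP.
  by case=> B; rewrite inE => /andP[_ /subsetP sBX] /sBX.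
move=> Xp; exists (pblock T p); last by rewrite mem_pblock covT inE.
rewrite inE pblock_mem ?covT ?inE //=; apply/subsetP=> q pq.
by apply: clX Xp; apply: esym; apply: same_pblock.
Qed.

(** A class [A] of [P1] contains a class [B] of [Q1] through a given point, and [B] contains the
    class of [P1] through that point, which is [A] again. *)
Lemma partition_eq_union (O : finType) (D : {set O * O})
    (P Q : {set {set O * O}}) :
  partition P D -> partition Q D ->
  (forall r, r \in P -> union_of Q r) -> (forall r, r \in Q -> union_of P r) ->
  P = Q.
Proof.
have half (P1 Q1 : {set {set O * O}}) : partition P1 D ->
    (forall r, r \in P1 -> union_of Q1 r) ->
    (forall r, r \in Q1 -> union_of P1 r) -> P1 \subset Q1.
  case/and3P=> _ tiP P0 PQ QP; apply/subsetP=> A PA.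
  have [A0 | [x Ax]] := set_0Vmem A; first by rewrite -A0 PA in P0.
  have [R [/subsetP sRQ covR]] := PQ A PA.
  have /bigcupP[B RB Bx] : x \in cover R by rewrite covR.
  suff -> : A = B by apply: sRQ.
  apply/eqP; rewrite eqEsubset -{2}covR bigcup_sup // andbT.
  have [R' [/subsetP sRP covR']] := QP B (sRQ B RB).
  have /bigcupP[C RC Cx] : x \in cover R' by rewrite covR'.
  rewrite -(def_pblock tiP PA Ax) (def_pblock tiP (sRP C RC) Cx).
  by rewrite -covR' bigcup_sup.
by move=> pP pQ PQ QP; apply/eqP; rewrite eqEsubset !half.
Qed.

Lemma in_rtr (O : finType) (r : {set O * O}) x y :
  ((x, y) \in rtr r) = ((y, x) \in r).
Proof.
apply/imsetP/idP => [[[a b] rab [-> ->]] //|ryx].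
by exists (y, x).
Qed.

Lemma in_diag_on (O : finType) (D : {set O}) x y :
  ((x, y) \in diag_on D) = (x \in D) && (x == y).
Proof.
apply/imsetP/andP => [[z Dz [-> ->]]|[Dx /eqP<-]]; first by rewrite eqxx.
by exists x.
Qed.

Lemma in_diagO (O : finType) (x y : O) : ((x, y) \in diagO O) = (x == y).
Proof. by rewrite in_diag_on inE. Qed.

Lemma in_rcomp (O : finType) (r s : {set O * O}) x z :
  reflect (exists2 y, (x, y) \in r & (y, z) \in s) ((x, z) \in rcomp r s).
Proof.
rewrite inE; apply: (iffP existsP) => [[y /andP[]]|[y r1 s1]]; first by exists y.
by exists y; rewrite r1.
Qed.

(** * Coherent configurations seen as edge colourings *)

Definition colour_of (O : finType) (T : {set {set O * O}}) (x y : O) :=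
  pblock T (x, y).

Section CoherentConfiguration.
Variables (O : finType) (T : {set {set O * O}}).
Hypothesis ccT : is_cc T.

Local Notation colour := (colour_of T).

Let partT : partition T [set: O * O]. Proof. by case: ccT. Qed.

Lemma in_cover_cc p : p \in cover T.
Proof. by case/and3P: partT => /eqP-> _ _; rewrite inE. Qed.

Lemma colour_in x y : colour x y \in T.
Proof. exact/pblock_mem/in_cover_cc. Qed.

Lemma in_colour x y : (x, y) \in colour x y.
Proof. by rewrite mem_pblock in_cover_cc. Qed.

Lemma in_basis t x y : t \in T -> ((x, y) \in t) = (colour x y == t).
Proof.
move=> Tt; apply/idP/eqP => [|<-]; last exact: in_colour.
by case/and3P: partT => _ tiT _; apply: def_pblock.
Qed.

Lemma basis_neq0 t : t \in T -> exists p, p \in t.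
Proof.
move=> Tt; have [t0|[p tp]] := set_0Vmem t; last by exists p.
by case/and3P: partT => _ _; rewrite -t0 Tt.
Qed.

Lemma colour_rtr x y : colour y x = rtr (colour x y).
Proof.
apply/eqP; rewrite -in_basis; first by rewrite in_rtr in_colour.
by case: ccT => _ _ + _; apply; apply: colour_in.
Qed.

Lemma colourC x y x' y' :
  colour x y = colour x' y' -> colour y x = colour y' x'.
Proof. by move=> eq_c; rewrite (colour_rtr x) (colour_rtr x') eq_c. Qed.

Lemma colour_cnum r s x z x' z' : r \in T -> s \in T ->
  colour x z = colour x' z' -> cnum r s x z = cnum r s x' z'.
Proof.
move=> Tr Ts eq_c; case: ccT => _ _ _ coh.
apply: (coh r s (colour x z) Tr Ts (colour_in _ _) (x, z) (x', z')).
  exact: in_colour.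
by rewrite eq_c in_colour.
Qed.

(** The intersection number counting [y] over [(x, z)] is positive, hence positive over [(x', z')].
    This transport of triangles is the form in which coherence is mostly used below. *)
Lemma colour_third x z x' z' y : colour x z = colour x' z' ->
  exists2 y', colour x y = colour x' y' & colour y z = colour y' z'.
Proof.
move=> eq_c.
have := colour_cnum (colour_in x y) (colour_in y z) eq_c.
have : 0 < cnum (colour x y) (colour y z) x z.
  by apply/card_gt0P; exists y; rewrite inE !in_colour.
move=> /[swap]-> /card_gt0P[y']; rewrite inE !in_basis ?colour_in //.
by case/andP=> /eqP<- /eqP<-; exists y'.
Qed.

Lemma union_of_rcomp X Y : union_of T X -> union_of T Y -> union_of T (rcomp X Y).
Proof.
move=> /(union_ofP _ partT) clX /(union_ofP _ partT) clY; apply/(union_ofP _ partT).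
move=> [x z] [x' z'] eq_c /in_rcomp[y Xxy Yyz].
have [y' eq1 eq2] := colour_third y eq_c.
by apply/in_rcomp; exists y'; [apply: clX Xxy | apply: clY Yyz].
Qed.

Lemma union_of_setI X Y : union_of T X -> union_of T Y -> union_of T (X :&: Y).
Proof.
move=> /(union_ofP _ partT) clX /(union_ofP _ partT) clY; apply/(union_ofP _ partT).
move=> p q eq_c; rewrite !inE.
by case/andP=> Xp Yp; rewrite (clX p) // (clY p).
Qed.

Lemma union_of_rtr X : union_of T X -> union_of T (rtr X).
Proof.
move=> /(union_ofP _ partT) clX; apply/(union_ofP _ partT).
move=> [x z] [x' z'] /colourC eq_c.
by rewrite !in_rtr; apply: clX.
Qed.

End CoherentConfiguration.

(** * Colours and separation in an equivalenced scheme *)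

Section Scheme.
Variables (O : finType) (S : {set {set O * O}}).
Hypotheses (schS : is_scheme S) (eqvS : equivalenced S).

Let ccS : is_cc S. Proof. by case: schS. Qed.
Local Notation colour := (colour_of S).
Let cin x y : colour x y \in S. Proof. exact: colour_in. Qed.

Lemma colour_diag x y : (colour x y == diagO O) = (x == y).
Proof. by rewrite -(in_basis ccS) ?in_diagO //; case: schS. Qed.

Lemma colour_eq_diag x y z : colour x x = colour y z -> y = z.
Proof.
by move=> eq_c; apply/eqP; rewrite -colour_diag -eq_c colour_diag.
Qed.

Lemma colour_xx x y : colour x x = colour y y.
Proof.
have E z : colour z z = diagO O by apply/eqP; rewrite colour_diag.
by rewrite !E.
Qed.

Lemma colour_sharp x y : (colour x y \in Ssharp S) = (x != y).
Proof. by rewrite !inE colour_diag (cin x y) andbT. Qed.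

(** All loops have the same colour, so an edge of colour [u] at some point [y] can be transported to
    [x] along the loops. *)
Lemma colour_ex x u : u \in S -> exists y, colour x y = u.
Proof.
move=> Su; have [[y z]] := basis_neq0 ccS Su.
rewrite (in_basis ccS) // => /eqP uE.
have [t t1 t2] := colour_third ccS z (colour_xx y x).
by exists t; rewrite -uE.
Qed.

(** Pointwise form of the condition that [u u^*] and [w w^*] share only the diagonal. *)
Definition separated (u w : {set O * O}) : Prop :=
  forall x z b g, colour x b = u -> colour z b = u ->
    colour x g = w -> colour z g = w -> x = z.

Lemma separatedC u w : separated u w -> separated w u.
Proof. by move=> sep x z b g xb zb xg zg; apply: (sep x z g b). Qed.

(* Counting pairs [(x, g)] with [(x, b) \in u], [(x, g) \in w] and [(b, g) \in s]
   first by [g] gives at most the valency [k] of [s]; counting first by [x]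
   gives [k] times the number of [g]. *)
Lemma separated_inj u w a b g g' : u \in Ssharp S -> separated u w ->
  colour a b = u -> colour a g = w -> colour a g' = w ->
  colour b g = colour b g' -> g = g'.
Proof.
move=> uS sep ab ag ag'.
have [-> /colour_eq_diag // | nbg eq_bg] := eqVneq b g.
have [_ Su] := setD1P uS.
have Sw : w \in S by rewrite -ag cin.
set s := colour b g in eq_bg.
have sS : s \in Ssharp S by rewrite colour_sharp.
have [_ Ss] := setD1P sS.
have [_ _ rS _] := ccS.
have nab : a != b by rewrite -colour_sharp ab.
have ruE : rtr u = colour b a by rewrite (colour_rtr ccS a) ab.
have ruS : rtr u \in Ssharp S by rewrite ruE colour_sharp eq_sym.
pose m := cnum w (rtr s) a b.
have cnt x : x \in nbr b (rtr u) -> \sum_(h in nbr b s) ((x, h) \in w) = m.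
  rewrite inE in_rtr (in_basis ccS) // => /eqP xb.
  rewrite /m -(colour_cnum ccS (x := x) (z := b)) ?rS //; last first.
    by rewrite -/(colour x b) xb -/(colour a b) ab.
  rewrite -big_mkcondr sum1dep_card; apply: eq_card => h.
  by rewrite !inE in_rtr andbC.
have cnt2 h : h \in nbr b s -> \sum_(x in nbr b (rtr u)) ((x, h) \in w) <= 1.
  move=> _; rewrite -big_mkcondr sum1dep_card; apply/card_le1_eqP => x z.
  rewrite !inE !in_rtr !(in_basis ccS) // =>
    /andP[/eqP xb /eqP xh]
    /andP[/eqP zb /eqP zh].
  exact: (sep z x b h).
have le_km : #|nbr b (rtr u)| * m <= #|nbr b s| * 1.
  rewrite -!sum_nat_const -(eq_bigr _ cnt) exchange_big /=.
  exact: leq_sum cnt2.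
have k_gt0 : 0 < #|nbr b s|.
  by apply/card_gt0P; exists g; rewrite inE in_colour.
move: le_km; rewrite (eqvS ruS sS b b) leq_pmul2l // => /card_le1_eqP; apply.
  by rewrite inE in_rtr !(in_basis ccS) // ag' -eq_bg !eqxx.
by rewrite inE in_rtr !(in_basis ccS) // ag !eqxx.
Qed.

(** * Splitting sets in terms of points *)

(** Pointwise form of membership in [Dsplit S u v]: [(x, z)] lies in [u u^*], [(z, y)] in [v v^*]
    and [(x, y)] in [w w^*]. *)
Definition splits (u v w : {set O * O}) : Prop :=
  [/\ u \in Ssharp S, v \in Ssharp S, w \in Ssharp S &
   forall x y z b d g, colour x b = u -> colour z b = u ->
     colour z d = v -> colour y d = v ->
     colour x g = w -> colour y g = w -> x = y].

(** One triangle suffices, since coherence transports it to every pair of the same colour as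
    [(x, z)]. *)
Lemma colour_relprod x y z u v : colour x y = u -> colour y z = v ->
  colour x z \in relprod S u v.
Proof.
move=> xy yz; rewrite inE (cin x z) /=; apply/subsetP=> -[x' z'].
rewrite (in_basis ccS) ?cin // => /eqP /esym eq_c.
have [y' eq1 eq2] := colour_third ccS y eq_c.
apply/in_rcomp; exists y'; first by rewrite -xy eq1 in_colour.
by rewrite -yz eq2 in_colour.
Qed.

Lemma colour_relprod_rtr x y b u : colour x b = u -> colour y b = u ->
  colour x y \in relprod S u (rtr u).
Proof.
move=> xb yb; apply: (colour_relprod xb).
by rewrite (colour_rtr ccS y) yb.
Qed.

Lemma Dsplit_splits u v w : u \in Ssharp S -> v \in Ssharp S ->
  w \in Dsplit S u v -> splits u v w.
Proof.
move=> Su Sv; rewrite inE => /andP[Sw /eqP disj]; split=> // x y z b d g.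
move=> xb zb zd yd xg yg; apply/eqP; rewrite -colour_diag.
rewrite -in_set1 -disj inE (colour_relprod_rtr xg yg) andbT.
apply/bigcupP; exists (colour x z); first exact: colour_relprod_rtr zb.
apply/bigcupP; exists (colour z y); first exact: colour_relprod_rtr yd.
exact: colour_relprod.
Qed.

Lemma splitsC u v w : splits u v w -> splits v u w.
Proof.
case=> Su Sv Sw spl; split=> // x y z b d g xb zb zd yd xg yg.
by apply: esym; apply: (spl y x z d b g).
Qed.

Lemma in_relprod_rtr x y t u : u \in S -> t \in relprod S u (rtr u) ->
  (x, y) \in t -> exists2 b, colour x b = u & colour y b = u.
Proof.
move=> Su; rewrite inE => /andP[_ /subsetP sub] /sub/in_rcomp[b].
by rewrite in_rtr !(in_basis ccS) // => /eqP xb /eqP yb; exists b.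
Qed.

Lemma splits_Dsplit u v w : splits u v w -> w \in Dsplit S u v.
Proof.
case=> /setD1P[_ Su] /setD1P[_ Sv] Sw spl; rewrite inE Sw /=.
have [_ Sw1] := setD1P Sw.
apply/eqP/setP=> t; rewrite inE in_set1; apply/andP/eqP.
  case=> /bigcupP[r ru /bigcupP[s sv]]; rewrite inE => /andP[St /subsetP trs] tw.
  have [[x y] txy] := basis_neq0 ccS St.
  have [g xg yg] := in_relprod_rtr Sw1 tw txy.
  have /in_rcomp[z rxz szy] := trs _ txy.
  have [b xb zb] := in_relprod_rtr Su ru rxz.
  have [d zd yd] := in_relprod_rtr Sv sv szy.
  move: txy; rewrite (spl x y z b d g) // (in_basis ccS) // => /eqP<-.
  by apply/eqP; rewrite colour_diag.
(* Conversely, each colour occurs at [x], so the loop at [x] lies in every product [r r^*], and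
   composing loops gives a loop. *)
move=> ->; have [_ St] := schS; have [[x _] _] := basis_neq0 ccS St.
have <- : colour x x = diagO O by apply/eqP; rewrite colour_diag.
have xx r : r \in S -> colour x x \in relprod S r (rtr r).
  by move=> Sr; have [b xb] := colour_ex x Sr; apply: (colour_relprod_rtr xb xb).
split; last exact: xx.
apply/bigcupP; exists (colour x x); first exact: xx.
apply/bigcupP; exists (colour x x); first exact: xx.
exact: colour_relprod.
Qed.

(** The path from [x] through [z] to [y] in [splits] can be read backwards. *)
Lemma Dsplit_sym u v w : u \in Ssharp S -> v \in Ssharp S ->
  (w \in Dsplit S u v) = (w \in Dsplit S v u).
Proof.
by move=> Su Sv; apply/idP/idP=> /Dsplit_splits spl;
  apply/splits_Dsplit/splitsC; apply: spl.
Qed.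

(** The degenerate case [y = z] of [splits], where both [v]-steps go to the same arbitrary neighbour
    [d]. *)
Lemma splits_separated u v w : splits u v w -> separated u w.
Proof.
case=> _ /setD1P[_ Sv] _ spl x z b g xb zb xg zg.
have [d zd] := colour_ex z Sv.
exact: (spl x z z b d g).
Qed.

(** * Matchings between the neighbourhoods of a base point *)

Section BasePoint.
Variable a : O.

Lemma colour_lift b b' g : colour a b = colour a b' ->
  exists2 g', colour a g = colour a g' & colour b g = colour b' g'.
Proof.
move=> /(colour_third ccS g)[g' ag gb]; exists g' => //.
exact: (colourC ccS).
Qed.

Lemma colour_a_neq b : b != a -> colour a b \in Ssharp S.
Proof. by rewrite colour_sharp eq_sym. Qed.

Lemma eq_colour_a b : colour a a = colour a b -> b = a.
Proof. by move/colour_eq_diag. Qed.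

(** With [splits_injr], this is the matching property: between the two neighbourhoods of [a], edges
    of one colour never share an end. *)
Lemma splits_injl b v g g' : splits (colour a b) v (colour a g) ->
  colour a g = colour a g' -> colour b g = colour b g' -> g = g'.
Proof.
move=> spl ag; have sep := splits_separated spl; case: spl => uS _ _ _.
exact: (separated_inj uS sep erefl erefl (esym ag)).
Qed.

Lemma splits_injr b v g b' : splits (colour a b) v (colour a g) ->
  colour a b = colour a b' -> colour g b = colour g b' -> b = b'.
Proof.
move=> spl ab; have sep := splits_separated spl; case: spl => _ _ wS _.
exact: (separated_inj wS (separatedC sep) erefl erefl (esym ab)).
Qed.

(* The points [z] (over [b'], [d2]) and [y] (over [g'], [d2]) found in the proof
   form with [a] the configuration of [splits], which forces [y = a]. *)
Lemma splits_comp b d g b' d' g' :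
  splits (colour a b) (colour a d) (colour a g) ->
  colour a b = colour a b' -> colour a d = colour a d' ->
  colour a g = colour a g' ->
  colour b g = colour b' g' -> colour g d = colour g' d' ->
  colour b d = colour b' d'.
Proof.
move=> spl ab ad ag bg gd.
have [d2 bd2 d2g] := colour_third ccS d bg.
have [z zb zd2] := colour_third ccS a bd2.
have gd2 := colourC ccS d2g.
have [y yg yd2] := colour_third ccS a gd2.
have a_y : a = y.
  case: (spl) => _ _ _; apply; first exact: (esym ab).
  - by apply: (colourC ccS); apply: esym; exact: zb.
  - exact: (esym zd2).
  - exact: (esym yd2).
  - exact: (esym ag).
  - by apply: (colourC ccS); apply: esym; exact: yg.
have ad2 : colour a d = colour a d2 by rewrite {2}a_y.
rewrite bd2; congr (colour _ _); apply: esym.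
apply: (@splits_injr d' (colour a b) g') => //; rewrite -?ad -?ag //.
  exact: splitsC.
by rewrite -gd.
Qed.

(** Two sides of a triangle of matchings determine the third. The lift of [g] along [(h', h)] is
    joined to [b'] in the colour of [(b, g)] by [splits_comp], so separation identifies it with
    [g']. *)
Lemma splits_link b g h b' g' h' :
  splits (colour a b) (colour a g) (colour a h) ->
  separated (colour a b) (colour a g) ->
  colour a b = colour a b' -> colour a g = colour a g' ->
  colour a h = colour a h' ->
  colour h b = colour h' b' -> colour b g = colour b' g' ->
  colour h g = colour h' g'.
Proof.
move=> spl sep ab ag ah hb bg.
have [g2 ag2 hg2] := colour_lift g ah; rewrite hg2; congr (colour_of _ _ _).
have bh := colourC ccS hb.
have bg2 := splits_comp spl ab ag2 ah bh hg2.
have [uS _ _ _] := spl.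
apply: (@separated_inj (colour a b) (colour a g) a b') => //.
by rewrite -bg2.
Qed.

(** A link from [(b, d)] to [(b', d')] through colour [w] yields one through any other splitting
    colour [w']: the matchings through [w] and those through [w'] all factor through one [q]. *)
Lemma linked_all u v w w' b d b' d' g g' k :
  condA S u v -> u \in Ssharp S -> v \in Ssharp S ->
  w \in Dsplit S u v -> w' \in Dsplit S u v ->
  colour a b = u -> colour a b' = u -> colour a d = v -> colour a d' = v ->
  colour a g = w -> colour a g' = w ->
  colour b g = colour b' g' -> colour g d = colour g' d' ->
  colour a k = w' ->
  exists k', [/\ colour a k' = w', colour b k = colour b' k' &
                 colour k d = colour k' d'].
Proof.
move=> cA Su Sv Dw Dw' ab ab' ad ad' ag ag' bg gd ak.
(* Condition (A): [q] splits each of the pairs [(u, w)], [(u, w')], [(v, w)] and [(v, w')]. *)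
have /set0Pn[q] := cA w w' Dw Dw'.
have Sw : w \in Ssharp S by case/setIdP: Dw.
have Sw' : w' \in Ssharp S by case/setIdP: Dw'.
rewrite 3!inE => /andP[/andP[/andP[]]].
move=> /(Dsplit_splits Su Sw) uw /(Dsplit_splits Su Sw') uw'.
move=> /(Dsplit_splits Sv Sw) vw /(Dsplit_splits Sv Sw') vw'.
have uvw := Dsplit_splits Su Sv Dw.
have Sq : q \in S by case: uw => _ _ /setD1P[].
have [h ah] := colour_ex a Sq.
rewrite -ab -ag -ah in uw; rewrite -ab -ak -ah in uw'.
rewrite -ad -ag -ah in vw; rewrite -ad -ak -ah in vw'.
rewrite -ab -ad -ag in uvw.
have eq_b : colour a b = colour a b' by rewrite ab.
have eq_d : colour a d = colour a d' by rewrite ad.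
have eq_g : colour a g = colour a g' by rewrite ag.
(* [h'] is lifted from [b'] alone; it is then linked to [g'] through [b'], and to [d'] through
   [g']. *)
have [h' eq_h bh] := colour_lift h eq_b.
have hg : colour h g = colour h' g'.
  apply: (splits_link uw (splits_separated uvw) eq_b eq_g eq_h) => //.
  exact: (colourC ccS).
have hd : colour h d = colour h' d'.
  apply: (splits_link (splitsC vw) _ eq_g eq_d eq_h) => //.
  exact: separatedC (splits_separated (splitsC uvw)).
(* Lifting [k] from [h'] rather than from [b'] allows composition through [h'] towards both [b'] and
   [d']. *)
have [k' eq_k hk] := colour_lift k eq_h.
exists k'; split; first by rewrite -eq_k.
  exact: (splits_comp uw' eq_b eq_k eq_h bh hk).
apply: (splits_comp (splitsC vw') eq_k eq_d eq_h _ hd).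
exact: (colourC ccS).
Qed.

(** * The equivalence whose classes are the composite matchings and the blocks at [a] *)

Variable wsel : {set O * O} -> {set O * O} -> {set O * O}.
Hypotheses
  (hA : forall u v, u \in Ssharp S -> v \in Ssharp S -> condA S u v)
  (hB : forall u v w, u \in Ssharp S -> v \in Ssharp S -> w \in Ssharp S ->
        condB S u v w)
  (hwsel : forall u v, u \in Ssharp S -> v \in Ssharp S ->
        wsel u v \in Dsplit S u v).

(* Pairs off [a] are related when they lie in the same element of [S0]; the
   remaining pairs are related according to [S1]. *)
Definition ext_rel : rel (O * O) := fun p q =>
  [&& colour a p.1 == colour a q.1, colour a p.2 == colour a q.2
    & [|| p.1 == a, p.2 == a |
       [exists g, [exists g',
         [&& colour a g == wsel (colour a p.1) (colour a p.2),
             colour a g' == colour a g,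
             colour p.1 g == colour q.1 g' & colour g p.2 == colour g' q.2]]]]].

Lemma ext_rel_colour1 b d b' d' :
  ext_rel (b, d) (b', d') -> colour a b = colour a b'.
Proof. by case/and3P=> /eqP. Qed.

Lemma ext_rel_colour2 b d b' d' :
  ext_rel (b, d) (b', d') -> colour a d = colour a d'.
Proof. by case/and3P=> _ /eqP. Qed.

Lemma ext_rel_base b d b' d' : (b == a) || (d == a) ->
  ext_rel (b, d) (b', d') =
  (colour a b == colour a b') && (colour a d == colour a d').
Proof. by rewrite /ext_rel /= orbA => ->; rewrite andbT. Qed.

Lemma colour_wsel b d : b != a -> d != a ->
  exists g, colour a g = wsel (colour a b) (colour a d).
Proof.
move=> ba da; apply: colour_ex.
by have /setIdP[/setD1P[]] := hwsel (colour_a_neq ba) (colour_a_neq da).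
Qed.

(** With [ext_rel_intro], this replaces the colour chosen by [wsel] by any splitting colour, which
    is what composition needs. *)
Lemma ext_rel_all b d b' d' k : b != a -> d != a ->
  ext_rel (b, d) (b', d') ->
  colour a k \in Dsplit S (colour a b) (colour a d) ->
  exists k', [/\ colour a k = colour a k', colour b k = colour b' k' &
                 colour k d = colour k' d'].
Proof.
move=> ba da; case/and3P; rewrite /= (negPf ba) (negPf da) /=.
move=> /eqP eq_b /eqP eq_d /existsP[g /existsP[g']].
case/and4P=> /eqP gw /eqP ag /eqP bg /eqP gd Dk.
have Su := colour_a_neq ba; have Sv := colour_a_neq da.
have [|k' [ak bk kd]] := linked_all (hA Su Sv) Su Sv (hwsel Su Sv) Dk erefl
  (esym eq_b) erefl (esym eq_d) gw _ bg gd erefl; first by rewrite ag.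
by exists k'.
Qed.

Lemma ext_rel_intro b d b' d' k k' : b != a -> d != a ->
  colour a b = colour a b' -> colour a d = colour a d' ->
  colour a k \in Dsplit S (colour a b) (colour a d) ->
  colour a k = colour a k' -> colour b k = colour b' k' ->
  colour k d = colour k' d' -> ext_rel (b, d) (b', d').
Proof.
move=> ba da eq_b eq_d Dk ak bk kd.
have Su := colour_a_neq ba; have Sv := colour_a_neq da.
have [g gw] := colour_wsel ba da.
have [g' [ag bg gd]] := linked_all (hA Su Sv) Su Sv Dk (hwsel Su Sv) erefl
  (esym eq_b) erefl (esym eq_d) erefl (esym ak) bk kd gw.
rewrite /ext_rel /= eq_b eq_d !eqxx -eq_b -eq_d; apply/or3P/Or33.
by apply/existsP; exists g; apply/existsP; exists g'; rewrite gw ag bg gd !eqxx.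
Qed.

Lemma eq_colour_a_neq b b' : colour a b = colour a b' -> (b' != a) = (b != a).
Proof. by move=> eq_b; rewrite ![_ == a]eq_sym -!colour_sharp eq_b. Qed.

Lemma ext_rel_baseP b d b' d' : ext_rel (b, d) (b', d') ->
  (b' == a) || (d' == a) = (b == a) || (d == a).
Proof.
move=> R1; have := eq_colour_a_neq (ext_rel_colour1 R1).
have := eq_colour_a_neq (ext_rel_colour2 R1).
by move=> /negb_inj -> /negb_inj ->.
Qed.

Lemma ext_rel_refl p : ext_rel p p.
Proof.
case: p => b d; have [?|] := boolP ((b == a) || (d == a)).
  by rewrite ext_rel_base // !eqxx.
rewrite negb_or => /andP[ba da]; have [g gw] := colour_wsel ba da.
apply: (ext_rel_intro (k := g) (k' := g)) => //.
by rewrite gw hwsel ?colour_a_neq.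
Qed.

Lemma ext_rel_sym p q : ext_rel p q -> ext_rel q p.
Proof.
case: p q => [b d] [b' d'] R1; have := ext_rel_baseP R1.
have eb := ext_rel_colour1 R1; have ed := ext_rel_colour2 R1.
have [ba|ba] := boolP ((b == a) || (d == a)) => ba'.
  by rewrite ext_rel_base // eb ed !eqxx.
move: ba; rewrite negb_or => /andP[ba da].
have [g gw] := colour_wsel ba da.
have Dg : colour a g \in Dsplit S (colour a b) (colour a d).
  by rewrite gw hwsel ?colour_a_neq.
have [g' [ag bg gd]] := ext_rel_all ba da R1 Dg.
apply: (ext_rel_intro (k := g') (k' := g)) => //.
- by rewrite (eq_colour_a_neq eb).
- by rewrite (eq_colour_a_neq ed).
- by rewrite -ag -eb -ed.
Qed.

Lemma ext_rel_trans q p r : ext_rel p q -> ext_rel q r -> ext_rel p r.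
Proof.
case: p q r => [b d] [b1 d1] [b2 d2] R1 R2.
have eb1 := ext_rel_colour1 R1; have ed1 := ext_rel_colour2 R1.
have eb2 := ext_rel_colour1 R2; have ed2 := ext_rel_colour2 R2.
have [ba|] := boolP ((b == a) || (d == a)).
  by rewrite ext_rel_base // eb1 ed1 eb2 ed2 !eqxx.
rewrite negb_or => /andP[ba da].
have [g gw] := colour_wsel ba da.
have Dg : colour a g \in Dsplit S (colour a b) (colour a d).
  by rewrite gw hwsel ?colour_a_neq.
have [g1 [ag1 bg1 gd1]] := ext_rel_all ba da R1 Dg.
have [|||g2 [ag2 bg2 gd2]] := @ext_rel_all _ _ _ _ g1 _ _ R2.
- by rewrite (eq_colour_a_neq eb1).
- by rewrite (eq_colour_a_neq ed1).
- by rewrite -eb1 -ed1 -ag1.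
by apply: (ext_rel_intro (k := g) (k' := g2)) => //; congruence.
Qed.

Lemma ext_rel_equiv : {in [set: O * O] & &, equivalence_rel ext_rel}.
Proof.
move=> p q r _ _ _; split=> [|Rpq]; first exact: ext_rel_refl.
by apply/idP/idP; apply: ext_rel_trans => //; apply: ext_rel_sym.
Qed.

Lemma ext_rel_swap b d b' d' :
  ext_rel (b, d) (b', d') -> ext_rel (d, b) (d', b').
Proof.
move=> R1; have eb := ext_rel_colour1 R1; have ed := ext_rel_colour2 R1.
have [ba|] := boolP ((b == a) || (d == a)).
  by rewrite ext_rel_base ?[_ || (b == a)]orbC // eb ed !eqxx.
rewrite negb_or => /andP[ba da].
have [g gw] := colour_wsel ba da.
have Dg : colour a g \in Dsplit S (colour a b) (colour a d).
  by rewrite gw hwsel ?colour_a_neq.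
have [g' [ag bg gd]] := ext_rel_all ba da R1 Dg.
apply: (ext_rel_intro (k := g) (k' := g')) => //; last exact: (colourC ccS).
  by rewrite Dsplit_sym ?colour_a_neq.
exact: (colourC ccS).
Qed.

(** The middle point must differ from [a], because a pair ending at [a] records only the colours of
    its ends. *)
Lemma ext_rel_comp b d e b' d' e' : d != a ->
  ext_rel (b, d) (b', d') -> ext_rel (d, e) (d', e') ->
  ext_rel (b, e) (b', e').
Proof.
move=> da R1 R2; have eb := ext_rel_colour1 R1; have ed := ext_rel_colour2 R1.
have ee := ext_rel_colour2 R2.
have [ba|] := boolP ((b == a) || (e == a)).
  by rewrite ext_rel_base // eb ee !eqxx.
rewrite negb_or => /andP[ba ea].
have Su := colour_a_neq ba; have Sv := colour_a_neq da.
have Sx := colour_a_neq ea.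
(* Condition (B): a single [w] splits all three pairs, so both links can use the same intermediate
   point [k]. *)
have /set0Pn[w] := hB Su Sv Sx.
rewrite !in_setI => /andP[/andP[Dbd Dde] Deb].
have [k kw] : exists k, colour a k = w.
  by apply: colour_ex; case/setIdP: Dbd => /setD1P[].
rewrite -{w}kw in Dbd Dde Deb.
have [k1 [ak1 bk1 kd1]] := ext_rel_all ba da R1 Dbd.
have [k2 [ak2 dk2 ke2]] := ext_rel_all da ea R2 Dde.
(* Both images of [k] are joined to [d'] in the same colour, and this colour is a matching. *)
have k12 : k1 = k2.
  have spl := Dsplit_splits Sv Sx Dde.
  rewrite ed ak1 in spl.
  apply: (splits_injl spl); first by rewrite -ak1.
  by rewrite -dk2; apply: esym; apply: (colourC ccS).
subst k2.
by apply: (ext_rel_intro (k := k) (k' := k1)) => //; rewrite Dsplit_sym ?colour_a_neq.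
Qed.

Lemma ext_rel_inj b d d' : b != a -> ext_rel (b, d) (b, d') -> d = d'.
Proof.
move=> ba R1; have ed := ext_rel_colour2 R1.
have [da|da] := eqVneq d a.
  by move: ed; rewrite da => /eq_colour_a.
have [g gw] := colour_wsel ba da.
have Dg : colour a g \in Dsplit S (colour a b) (colour a d).
  by rewrite gw hwsel ?colour_a_neq.
have [g' [ag bg gd]] := ext_rel_all ba da R1 Dg.
have spl := Dsplit_splits (colour_a_neq ba) (colour_a_neq da) Dg.
have gg := splits_injl spl ag bg; subst g'.
exact: (splits_injr (splitsC spl) ed gd).
Qed.

(** With [ext_rel_inj], the class of [(b, d)] for [b != a] is the graph of a function on the
    neighbours of [a] in the colour of [b]. *)
Lemma ext_rel_ex b b' d : colour a b = colour a b' ->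
  exists d', ext_rel (b, d) (b', d').
Proof.
move=> eb; have [ba|] := boolP ((b == a) || (d == a)).
  by exists d; rewrite ext_rel_base // eb !eqxx.
rewrite negb_or => /andP[ba da].
have [g gw] := colour_wsel ba da.
have [g' ag bg] := colour_lift g eb.
have [d' ad gd] := colour_lift d ag.
exists d'; apply: (ext_rel_intro (k := g) (k' := g')) => //.
by rewrite gw hwsel ?colour_a_neq.
Qed.

Lemma ext_rel_colour b d b' d' :
  ext_rel (b, d) (b', d') -> colour b d = colour b' d'.
Proof.
move=> R1; have eb := ext_rel_colour1 R1; have ed := ext_rel_colour2 R1.
have [ba|ba] := eqVneq b a.
  by move: eb; rewrite ba => /eq_colour_a->.
have [da|da] := eqVneq d a.
  by move: ed; rewrite da => /eq_colour_a->; apply: (colourC ccS).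
have [g gw] := colour_wsel ba da.
have Dg : colour a g \in Dsplit S (colour a b) (colour a d).
  by rewrite gw hwsel ?colour_a_neq.
have [g' [ag bg gd]] := ext_rel_all ba da R1 Dg.
have spl := Dsplit_splits (colour_a_neq ba) (colour_a_neq da) Dg.
exact: splits_comp spl eb ed ag bg gd.
Qed.

(** * Coherence of the partition into classes *)

Definition ext_basis : {set {set O * O}} := equivalence_partition ext_rel setT.

Lemma ext_basis_partition : partition ext_basis [set: O * O].
Proof. exact: equivalence_partitionP ext_rel_equiv. Qed.

Lemma in_ext_basis t p q : t \in ext_basis -> p \in t -> (q \in t) = ext_rel p q.
Proof.
case/imsetP=> p0 _ ->; rewrite !inE /= => Rp0.
by apply/idP/idP; apply: ext_rel_trans => //; apply: ext_rel_sym.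
Qed.

Lemma ext_basis_union (X : {set O * O}) :
  (forall p q, ext_rel p q -> p \in X -> q \in X) ->
  union_of ext_basis X.
Proof.
move=> clX; apply/(union_ofP _ ext_basis_partition) => p q eq_pq; apply: clX.
rewrite -(pblock_equivalence_partition ext_rel_equiv) ?inE // -/ext_basis eq_pq.
by rewrite pblock_equivalence_partition ?inE ?ext_rel_refl //; apply: ext_rel_equiv.
Qed.

(** Transport of triangles by an injection in the apex, so that intersection numbers can be
    compared. The apex is lifted from an end other than [a], where lifts are unique, and the
    remaining side comes from composing through that end. *)
Lemma ext_rel_third x z x' z' : (x != a) || (z != a) ->
  ext_rel (x, z) (x', z') ->
  exists2 f : O -> O, injective f &
    forall y, ext_rel (x, y) (x', f y) && ext_rel (y, z) (f y, z').
Proof.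
move=> xza Rxz; have [xa|xa] := boolP (x != a).
  have ex y : exists y', ext_rel (x, y) (x', y') && ext_rel (y, z) (y', z').
    have [y' Ry] := ext_rel_ex y (ext_rel_colour1 Rxz).
    by exists y'; rewrite Ry; apply: ext_rel_comp xa (ext_rel_swap Ry) Rxz.
  exists (fun y => xchoose (ex y)) => [y1 y2 eq_y|y]; last exact: (xchooseP (ex y)).
  have /andP[R1 _] := xchooseP (ex y1); have /andP[R2 _] := xchooseP (ex y2).
  apply: (ext_rel_inj xa); apply: ext_rel_trans R1 _.
  by rewrite eq_y; apply: ext_rel_sym.
(* Now [x = a], so the apex is lifted from [z] instead. *)
move: xza; rewrite (negPf xa) /= => za; have Rzx := ext_rel_swap Rxz.
have ex y : exists y', ext_rel (x, y) (x', y') && ext_rel (y, z) (y', z').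
  have [y' Ry] := ext_rel_ex y (ext_rel_colour1 Rzx).
  by exists y'; rewrite (ext_rel_swap Ry) andbT; apply: ext_rel_comp za Rxz Ry.
exists (fun y => xchoose (ex y)) => [y1 y2 eq_y|y]; last exact: (xchooseP (ex y)).
have /andP[_ R1] := xchooseP (ex y1); have /andP[_ R2] := xchooseP (ex y2).
apply: (ext_rel_inj za); apply: ext_rel_trans (ext_rel_swap R1) _.
by rewrite eq_y; apply/ext_rel_sym/ext_rel_swap.
Qed.

Lemma ext_rel_class t p q : t \in ext_basis -> ext_rel p q -> p \in t -> q \in t.
Proof. by move=> Tt Rpq tp; rewrite (in_ext_basis _ Tt tp). Qed.

Lemma ext_cnum_le r s x z x' z' : r \in ext_basis -> s \in ext_basis ->
  ext_rel (x, z) (x', z') -> cnum r s x z <= cnum r s x' z'.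
Proof.
move=> Tr Ts Rxz; have [xza|] := boolP ((x != a) || (z != a)).
  have [f inj_f Rf] := ext_rel_third xza Rxz.
  rewrite /cnum -(card_imset _ inj_f); apply/subset_leq_card/subsetP=> y'.
  case/imsetP=> y; rewrite !inE => /andP[rxy syz] ->.
  have /andP[Rxy Ryz] := Rf y.
  by rewrite (ext_rel_class Tr Rxy rxy) (ext_rel_class Ts Ryz syz).
(* The remaining pair [(a, a)] is related only to itself. *)
rewrite negb_or !negbK => /andP[/eqP xa /eqP za].
move: (ext_rel_colour1 Rxz) (ext_rel_colour2 Rxz); rewrite xa za.
by move=> /eq_colour_a-> /eq_colour_a->.
Qed.

Lemma ext_basis_cc : is_cc ext_basis.
Proof.
split; first exact: ext_basis_partition.
- apply: ext_basis_union => -[x y] [x' y'] Rxy; rewrite !in_diagO => /eqP eq_xy.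
  by rewrite -colour_diag -(ext_rel_colour Rxy) colour_diag eq_xy.
- move=> r /imsetP[[x y] _ ->]; apply/imsetP; exists (y, x) => //.
  apply/setP=> -[y' x']; rewrite in_rtr !inE.
  by apply/idP/idP; apply: ext_rel_swap.
move=> r s t Tr Ts Tt [x z] [x' z'] txz; rewrite (in_ext_basis _ Tt txz) => Rxz.
by apply/eqP; rewrite eqn_leq !ext_cnum_le //; apply: ext_rel_sym.
Qed.

Lemma ext_basis_admissible : ext_admissible S a ext_basis.
Proof.
split; first exact: ext_basis_cc.
  apply: ext_basis_union => -[x y] [x' y'] Rxy; rewrite !inE => /eqP[xa ya].
  move: (ext_rel_colour1 Rxy) (ext_rel_colour2 Rxy); rewrite xa ya.
  by move=> /eq_colour_a-> /eq_colour_a->.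
move=> s Ss; apply: ext_basis_union => -[x y] [x' y'] /ext_rel_colour.
by rewrite !(in_basis ccS) // => ->.
Qed.

(** * The classes are the elements of [S0] and [S1] *)

Lemma ext_class_piece b d g : b != a -> d != a ->
  colour a g = wsel (colour a b) (colour a d) ->
  rcomp (colour b g :&: setX (nbr a (colour a b)) (nbr a (colour a g)))
        (colour g d :&: setX (nbr a (colour a g)) (nbr a (colour a d)))
  = [set q in [set: O * O] | ext_rel (b, d) q].
Proof.
move=> ba da gw.
have Dg : colour a g \in Dsplit S (colour a b) (colour a d).
  by rewrite gw hwsel ?colour_a_neq.
apply/setP=> -[b' d']; apply/in_rcomp/idP; rewrite !inE /=.
  case=> g'; rewrite !inE /= !(in_basis ccS) ?cin //.
  case/and3P=> /eqP bg /eqP ab /eqP ag /and3P[/eqP gd _ /eqP ad].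
  exact: (ext_rel_intro (k := g) (k' := g')).
move=> R1; have [g' [ag bg gd]] := ext_rel_all ba da R1 Dg.
exists g'; rewrite !inE /= !(in_basis ccS) ?cin //.
  by rewrite bg ag (ext_rel_colour1 R1) !eqxx.
by rewrite gd ag (ext_rel_colour2 R1) !eqxx.
Qed.

Lemma ext_class_base b d : (b == a) || (d == a) ->
  [set q in [set: O * O] | ext_rel (b, d) q] =
  setX (nbr a (colour a b)) (nbr a (colour a d)).
Proof.
move=> ba; apply/setP=> -[b' d']; rewrite !inE /= ext_rel_base //.
by rewrite !(in_basis ccS) ?cin // ![_ == colour a b']eq_sym
  ![_ == colour a d']eq_sym.
Qed.

Lemma nbr_base : nbr a (colour a a) = [set a].
Proof.
apply/setP=> x; rewrite !inE (in_basis ccS) ?cin //.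
by apply/eqP/eqP=> [/esym/eq_colour_a|->].
Qed.

Lemma relprod_rtrP u w b g : colour a b = u -> colour a g = w ->
  colour b g \in relprod S (rtr u) w.
Proof. by move=> <- <-; rewrite -(colour_rtr ccS); apply: colour_relprod. Qed.

(** A triangle witnessing [s] is moved so that its edge of colour [u] becomes [(a, b0)]. Thus [s]
    has an edge from any prescribed [b0] into the [w]-neighbours of [a]. *)
Lemma in_relprod_ex u w s b0 : u \in S -> w \in S -> colour a b0 = u ->
  s \in relprod S (rtr u) w -> exists2 g, colour a g = w & colour b0 g = s.
Proof.
move=> Su Sw ab; rewrite inE => /andP[Ss /subsetP sub].
have [[b g] sbg] := basis_neq0 ccS Ss.
have /in_rcomp[x] := sub _ sbg.
rewrite in_rtr !(in_basis ccS) // => /eqP xb /eqP xg.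
have [g' bg' g'x] : exists2 g', colour b g = colour b0 g' & colour g x = colour g' a.
  apply: (colour_third ccS); apply: (colourC ccS).
  by rewrite -[LHS]/(colour x b) xb ab.
exists g'; first by rewrite -(colourC ccS g'x).
by apply/eqP; rewrite -bg' -(in_basis ccS).
Qed.

Lemma S0_S1_ext_basis : S0 S a wsel :|: S1 S a = ext_basis.
Proof.
apply/setP=> X; rewrite in_setU; apply/orP/imsetP.
  case.
    case/bigcupP=> u Su /bigcupP[v Sv] /imset2P[X1 X2].
    case/imsetP=> s sP -> /imsetP[t tP ->] ->.
    have [_ Su1] := setD1P Su; have [_ Sv1] := setD1P Sv.
    have Sw : wsel u v \in S.
      by have /setIdP[/setD1P[]] := hwsel Su Sv.
    (* The points are chosen in a chain [b], [g], [d], so that the given composite contains [(b, d)]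
       and is its class. *)
    have [b ab] := colour_ex a Su1.
    have [g ag bg] := in_relprod_ex Su1 Sw ab sP.
    have [d ad gd] := in_relprod_ex Sw Sv1 ag tP.
    exists (b, d) => //; rewrite -(ext_class_piece (g := g)) ?ab ?ad ?ag ?bg ?gd //.
      by rewrite eq_sym -colour_sharp ab.
    by rewrite eq_sym -colour_sharp ad.
  case/setUP=> /imsetP[v Sv ->]; have [d ad] := colour_ex a Sv.
    by exists (a, d); rewrite // ext_class_base ?eqxx //= nbr_base ad.
  by exists (d, a); rewrite // ext_class_base ?eqxx ?orbT //= nbr_base ad.
case=> -[b d] _ ->; have [ba|ba] := eqVneq b a.
  right; rewrite ba ext_class_base ?eqxx // nbr_base; apply/setUP; left.
  by apply/imsetP; exists (colour a d); rewrite ?cin.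
have [da|da] := eqVneq d a.
  right; rewrite da ext_class_base ?eqxx ?orbT // nbr_base; apply/setUP; right.
  by apply/imsetP; exists (colour a b); rewrite ?cin.
left; have [g gw] := colour_wsel ba da.
apply/bigcupP; exists (colour a b); first exact: colour_a_neq.
apply/bigcupP; exists (colour a d); first exact: colour_a_neq.
rewrite -(ext_class_piece ba da gw) /Saw -gw; apply/imset2P; apply: Imset2spec.
- by apply/imsetP; exists (colour b g) => //; apply: relprod_rtrP.
- by apply/imsetP; exists (colour g d) => //; apply: relprod_rtrP.
- by [].
Qed.

(** * Minimality and uniqueness of the extension *)

Lemma admissible_union_of_ext T t : ext_admissible S a T ->
  t \in S0 S a wsel :|: S1 S a -> union_of T t.
Proof.
case=> ccT Ta TS.
(* The blocks at [a] come from composing [(a, a)] with [v]; transposition and composition then give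
   all products of two neighbourhoods. *)
have Tl v : v \in S -> union_of T (setX [set a] (nbr a v)).
  move=> /TS Tv; suff -> : setX [set a] (nbr a v) = rcomp [set (a, a)] v.
    exact: union_of_rcomp.
  apply/setP=> -[x y]; rewrite in_setX /=; apply/andP/in_rcomp; rewrite ?inE.
    by case=> /eqP-> avy; exists a; rewrite ?inE.
  by case=> z; rewrite inE => /eqP[-> ->].
have Tr v : v \in S -> union_of T (setX (nbr a v) [set a]).
  move=> /Tl Tv; suff -> : setX (nbr a v) [set a] = rtr (setX [set a] (nbr a v)).
    exact: union_of_rtr.
  by apply/setP=> -[x y]; rewrite in_rtr !inE /= andbC.
have Tlr u v : u \in S -> v \in S -> union_of T (setX (nbr a u) (nbr a v)).
  move=> /Tr Tu /Tl Tv.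
  suff -> : setX (nbr a u) (nbr a v) =
      rcomp (setX (nbr a u) [set a]) (setX [set a] (nbr a v)).
    exact: union_of_rcomp.
  apply/setP=> -[x y]; rewrite in_setX /=; apply/andP/in_rcomp; rewrite ?inE.
    by case=> aux avy; exists a; rewrite !inE /= ?aux ?avy eqxx.
  by case=> z; rewrite !inE /= => /andP[-> _] /andP[_ ->].
have TSa u v X : u \in S -> v \in S -> X \in Sa S a u v -> union_of T X.
  move=> Su Sv /imsetP[s /setIdP[Ss _] ->].
  by apply: union_of_setI => //; [apply: TS | apply: Tlr].
case/setUP=> [|/setUP[]/imsetP[v Sv ->]]; [|exact: Tl|exact: Tr].
case/bigcupP=> u Su /bigcupP[v Sv] /imset2P[X Y XP YP ->].
have /setIdP[/setD1P[_ Sw] _] := hwsel Su Sv.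
have [_ Su1] := setD1P Su; have [_ Sv1] := setD1P Sv.
apply: union_of_rcomp => //; first exact: TSa XP.
exact: TSa YP.
Qed.

Lemma ext_basis_extension : is_extension S a ext_basis.
Proof.
split; first exact: ext_basis_admissible.
by move=> T adT t; rewrite -S0_S1_ext_basis; apply: admissible_union_of_ext.
Qed.

(** Two coarsest configurations consist of unions of classes of each other. *)
Lemma extension_unique T : is_extension S a T -> T = ext_basis.
Proof.
case=> adT minT; have [adE minE] := ext_basis_extension.
have [[pT _ _ _] _ _] := adT.
by apply: partition_eq_union pT ext_basis_partition _ _ => t;
  [apply: minT | apply: minE].
Qed.

(** * Semiregularity and fibers *)

Lemma ext_basis_semiregular : semiregular_off a ext_basis.
Proof.
move=> b ba s Ts _; apply/card_le1_eqP => d d'; rewrite !inE => sd' sd.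
by apply: (ext_rel_inj ba); rewrite -(in_ext_basis _ Ts sd).
Qed.

Lemma ext_rel_diag x p : ext_rel (x, x) p = (p \in diag_on (nbr a (colour a x))).
Proof.
case: p => y z; rewrite in_diag_on inE (in_basis ccS) ?cin //.
apply/idP/andP=> [Rxy|[/eqP axy /eqP<-]].
  rewrite (ext_rel_colour1 Rxy) eqxx; split=> //.
  by rewrite -colour_diag -(ext_rel_colour Rxy) colour_diag.
(* Some pair [(y, z')] is related to [(x, x)]; it has the diagonal colour, so [z' = y]. *)
have [z' Rz] := ext_rel_ex x (esym axy).
suff E : y = z' by rewrite {2}E.
by apply/eqP; rewrite -colour_diag -(ext_rel_colour Rz) colour_diag.
Qed.

Lemma fibers_ext_basis : fibers ext_basis = [set nbr a u | u in S].
Proof.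
apply/setP=> D; rewrite inE; apply/idP/imsetP.
  move=> TD; have [[x y] Dxy] := basis_neq0 ext_basis_cc TD.
  move: (Dxy); rewrite in_diag_on => /andP[Dx /eqP eq_xy]; subst y.
  exists (colour a x); rewrite ?cin //; apply/setP=> z.
  transitivity ((z, z) \in diag_on D); first by rewrite in_diag_on eqxx andbT.
  by rewrite (in_ext_basis _ TD Dxy) ext_rel_diag in_diag_on eqxx andbT.
case=> u Su ->; have [x ax] := colour_ex a Su.
apply/imsetP; exists (x, x) => //.
by apply/setP=> p; rewrite !inE ext_rel_diag ax.
Qed.

End BasePoint.

End Scheme.

(** The extension is given by a predicate: the first conjunct is existence, the second describes
    every [T] satisfying it. Quantifying over [wsel] covers all choices of splitting colours. *)
Theorem theorem4p4 (O : finType) (S : {set {set O * O}}) (a0 : O)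
  (wsel : {set O * O} -> {set O * O} -> {set O * O}) :
  is_scheme S -> equivalenced S ->
  (forall u v, u \in Ssharp S -> v \in Ssharp S -> condA S u v) ->
  (forall u v w, u \in Ssharp S -> v \in Ssharp S -> w \in Ssharp S -> condB S u v w) ->
  (forall u v, u \in Ssharp S -> v \in Ssharp S -> wsel u v \in Dsplit S u v) ->
  is_extension S a0 (S0 S a0 wsel :|: S1 S a0) /\
  (forall T, is_extension S a0 T ->
     [/\ T = S0 S a0 wsel :|: S1 S a0,
         semiregular_off a0 T &
         fibers T = [set nbr a0 u | u in S]]).
Proof.
move=> schS eqvS hA hB hwsel.
rewrite (S0_S1_ext_basis schS eqvS) //; split; first exact: ext_basis_extension.
move=> T extT; rewrite (extension_unique schS eqvS hA hB hwsel extT); split=> //.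
  exact: ext_basis_semiregular.
exact: fibers_ext_basis.
Qed.
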